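(* Let $q\ge2$ and let $\phi:\mathbb R\to\mathbb R$ be bounded below, differentiable and non-increasing, with $\phi'(0)<0$ and $\phi(t)+\phi(-t)=2\phi(0)$ for all $t\in\mathbb R$. Then the surrogate $\mathcal L_r$ (whose noisy counterpart is the modified loss $\tilde{\mathcal L}_r$) is consistent with respect to the ranking loss $L_r$: there exists a nondecreasing concave function $\xi:[0,\infty)\to[0,\infty)$ with $\xi(0)=0$ and $\xi(t)\to0$ as $t\downarrow0$ such that for every distribution $\mathcal D$ on $\mathcal X\times\{-1,+1\}^q$ and every measurable $\mathbf f:\mathcal X\to\mathbb R^q$, $$R_{L_r}(\mathbf f)-R^*_{L_r}\le\xi\big(R_{\mathcal L_r}(\mathbf f)-R^*_{\mathcal L_r}\big).$$
   Context: Fix a feature space $\mathcal X$, $(x,\mathbf y)\sim\mathcal D$ with $\mathbf y\in\{-1,+1\}^q$, and $\mathbf f=(f_1,\dots,f_q)$. Surrogate: $\mathcal L_r(\mathbf f(x),\mathbf y)=\sum_{1\le j<k\le q}[\mathbb 1(y_j=+1,y_k=-1)\phi(f_j(x)-f_k(x))+\mathbb 1(y_j=-1,y_k=+1)\phi(f_k(x)-f_j(x))]$. Ranking loss: $L_r(\mathbf f(x),\mathbf y)=\sum_{1\le j<k\le q}[\mathbb 1(y_j<y_k)\ell(j,k)+\mathbb 1(y_j>y_k)\ell(k,j)]$ with $\ell(j,k)=\mathbb 1(f_j(x)>f_k(x))+\tfrac12\mathbb 1(f_j(x)=f_k(x))$. Risks $R_L(\mathbf f)=\mathbb E_{\mathcal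 D}[L(\mathbf f(x),\mathbf y)]$ and $R^*_L=\inf_{\mathbf g}R_L(\mathbf g)$ over measurable $\mathbf g:\mathcal X\to\mathbb R^q$, for $L\in\{L_r,\mathcal L_r\}$. (The modified loss $\tilde{\mathcal L}_r$ is the noise-corrected pairwise loss satisfying $\mathbb E_{\tilde{\mathbf y}\mid\mathbf y}[\tilde{\mathcal L}_r(\mathbf t,\tilde{\mathbf y})]=\mathcal L_r(\mathbf t,\mathbf y)$ under class-conditional independent label flips.) *)

(* Defs.v *)
From HB Require Import structures.
From mathcomp Require Import all_boot all_order all_algebra.
From mathcomp Require Import all_classical all_reals all_analysis.
Set Implicit Arguments. Unset Strict Implicit. Unset Printing Implicit Defensive.
Import Order.TTheory GRing.Theory Num.Theory.
Import numFieldNormedType.Exports.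
Local Open Scope classical_set_scope.
Local Open Scope ring_scope.

(* Label vectors y in {-1,+1}^q, encoded as y : 'I_q -> bool,
   with true = +1 and false = -1. *)
Definition labels (q : nat) : Type := {ffun 'I_q -> bool}.
HB.instance Definition _ q := Choice.on (labels q).
HB.instance Definition _ q :=
  isPointed.Build (labels q) [ffun=> true].
HB.instance Definition _ q := @isMeasurable.Build default_measure_display
  (labels q) discrete_measurable discrete_measurable0
  discrete_measurableC discrete_measurableU.

Section losses.
Variables (R : realType) (q : nat).

Definition surr_loss (phi : R -> R) (t : 'I_q -> R) (y : labels q) : R :=
  \sum_(j < q) \sum_(k < q | (j < k)%N)
    ((y j && ~~ y k)%:R * phi (t j - t k) +
     (~~ y j && y k)%:R * phi (t k - t j)).

Definition ell (t : 'I_q -> R) (j k : 'I_q) : R :=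
  ((t k < t j)%R : bool)%:R + 2^-1 * ((t j == t k) : bool)%:R.

Definition rank_loss (t : 'I_q -> R) (y : labels q) : R :=
  \sum_(j < q) \sum_(k < q | (j < k)%N)
    ((~~ y j && y k)%:R * ell t j k + (y j && ~~ y k)%:R * ell t k j).

End losses.

Section risks.
Variables (d : measure_display) (X : measurableType d) (R : realType) (q : nat).

Definition meas_scorer (f : 'I_q -> X -> R) : Prop :=
  forall i, measurable_fun setT (f i).

Definition risk (D : probability (X * labels q)%type R)
  (L : ('I_q -> R) -> labels q -> R) (f : 'I_q -> X -> R) : R :=
  Rintegral D setT (fun z => L (fun i => f i z.1) z.2).

Definition bayes_risk (D : probability (X * labels q)%type R)
  (L : ('I_q -> R) -> labels q -> R) : R :=
  inf [set risk D L g | g in meas_scorer].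

End risks.

(* Main.v *)
(* Both losses depend on y only through the differences y_j - y_k: up to terms
   common to all scorers, the surrogate is a sum of (y_j - y_k) phi(f_j - f_k)
   (labels read as 0/1, by the symmetry of phi) and the ranking loss a sum of
   -(y_j - y_k) ell(j, k). Hence y_j may be replaced under the expectation by
   eta_j(x) = P(y_j = +1 | x). With M = phi(0) - inf phi > 0, the best
   conditional values are attained pairwise by the signs of eta_j - eta_k, in
   the limit n -> oo along the scorers n * eta for the surrogate, and
   pointwise the surrogate regret is at least M times the ranking regret. So
   xi(t) = t / M works. *)
Require Import Defs.
From HB Require Import structures.
From mathcomp Require Import all_boot all_order all_algebra.
From mathcomp Require Import all_classical all_reals all_analysis.
From mathcomp Require Import measurable_realfun ring lra.
Set Implicit Arguments. Unset Strict Implicit. Unset Printing Implicit Defensive.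
Import Order.TTheory GRing.Theory Num.Theory.
Import numFieldNormedType.Exports.
Local Open Scope classical_set_scope.
Local Open Scope ring_scope.

(** * Integrals of bounded functions and against restricted measures *)

Lemma bounded_integrable {d} {T : measurableType d} {R : realType}
    (m : {finite_measure set T -> \bar R}) (h : T -> R) (K : R) :
  measurable_fun setT h -> (forall t, `|h t| <= K) ->
  m.-integrable setT (EFin \o h).
Proof.
move=> mh hK; apply: measurable_bounded_integrable => //.
  by rewrite fin_num_fun_lty.
exists K; split; first by rewrite num_real.
by move=> M KM t _ /=; exact: le_trans (hK t) (ltW KM).
Qed.

(** The complement of [B] has mass zero under the restricted measure, and the two measures agree on
    subsets of [B]. *)
Lemma integral_mrestr {d} {T : measurableType d} {R : realType}
    (m : {measure set T -> \bar R}) (B : set T) (mB : measurable B)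
    (f : T -> \bar R) : measurable_fun setT f ->
  (\int[mrestr m mB]_x f x = \int[m]_(x in B) f x)%E.
Proof.
move=> mf; rewrite -(setUv B) integral_setU//=; first last.
- exact/disj_set2P/setICr.
- by rewrite setUv.
- exact: measurableC.
rewrite [X in (_ + X)%E]null_set_integral ?adde0//.
- by apply: eq_measure_integral => A mA AB; rewrite /= /mrestr setIidl.
- exact: measurableC.
- exact: measurable_funTS.
- by rewrite /= /mrestr setICl measure0.
Qed.

(** * Image measures, and conditional probability as a Radon-Nikodym density *)

Section finite_pushforward.
Context {d d'} {T : measurableType d} {X : measurableType d'} {R : realType}.
Variables (m : {finite_measure set T -> \bar R}) (p : T -> X).
Hypothesis mp : measurable_fun setT p.

Let fin_pushforward : fin_num_fun (pushforward m p).
Proof.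
move=> A mA; apply: fin_num_measure.
by rewrite -[X in measurable X]setTI; exact: mp.
Qed.

Let m' : {measure set X -> \bar R} := ltac:(by unshelve refine (pushforward m p)).

(** Packed as a finite measure so that Radon-Nikodym derivatives can be taken between image
    measures. *)
Definition finite_pushforward : {finite_measure set X -> \bar R} :=
  HB.pack (pushforward m p : set X -> \bar R) (Measure.class m')
   (@Measure_isFinite.Build _ _ _ m' fin_pushforward).

End finite_pushforward.

Section conditional_density.
Context {d d'} {T : measurableType d} {X : measurableType d'} {R : realType}.
Variables (P : {finite_measure set T -> \bar R}) (p : T -> X) (B : set T).
Hypotheses (mp : measurable_fun setT p) (mB : measurable B).

Let mpre A : measurable A -> measurable (p @^-1` A).
Proof. by move=> mA; rewrite -[X in measurable X]setTI; exact: mp. Qed.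

Let mu : {finite_measure set X -> \bar R} := finite_pushforward P mp.
Let nu : {finite_measure set X -> \bar R} := finite_pushforward (mrestr P mB) mp.

Let nu_mu : nu `<< mu.
Proof.
apply/null_content_dominatesP => A mA muA0.
apply/eqP; rewrite -measure_le0 -muA0.
have mpA := mpre mA.
rewrite /nu /mu /= /pushforward /mrestr.
by apply: le_measure; rewrite ?inE//; exact: measurableI.
Qed.

(** The witness is the derivative of [nu], the image of [P] restricted to [B], with respect to [mu],
    the image of [P]: the conditional probability of [B] given [p]. *)
Lemma conditional_density : exists eta : X -> R,
  [/\ measurable_fun setT eta, P.-integrable setT (EFin \o (eta \o p)) &
   forall (h : X -> R) (K : R), measurable_fun setT h ->
     (forall x, `|h x| <= K) ->
     \int[P]_t (\1_B t * h (p t)) = \int[P]_t (eta (p t) * h (p t))].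
Proof.
pose e := Radon_Nikodym (charge_of_finite_measure nu) mu.
have efin x : e x \is a fin_num by exact: Radon_Nikodym_fin_num.
have ie : mu.-integrable setT e by exact: Radon_Nikodym_integrable.
have me : measurable_fun setT e by exact: measurable_int ie.
(* The derivative is finite everywhere, so [fine] makes it real-valued without loss. *)
have Ee : EFin \o (fine \o e) = e by apply/funext => x /=; rewrite fineK.
have efp : EFin \o ((fine \o e) \o p) = e \o p.
  by apply/funext => t /=; rewrite fineK.
have iep : P.-integrable setT (e \o p).
  apply/integrableP; split; first exact: measurableT_comp.
  have /integrableP[_] := ie.
  rewrite (ge0_integral_pushforward mp P measurableT (f := fun x => `|e x|%E)) //.
  exact: measurableT_comp.
have mfe : measurable_fun setT (fine \o e) by apply/measurable_EFinP; rewrite Ee.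
exists (fine \o e); split => //; first by rewrite efp.
move=> h K mh hK.
have ih : (mrestr P mB).-integrable setT (EFin \o (h \o p)).
  apply: (@bounded_integrable _ _ _ (mrestr P mB) _ K) => [|t]; last exact: hK.
  exact: measurableT_comp.
rewrite /Rintegral; congr fine.
(* The integral over [B] is carried to [nu] on [X], then through the density to [mu], and back to
   [P] along [p]. *)
transitivity (\int[P]_(t in B) (h (p t))%:E)%E.
  rewrite [RHS]integral_mkcond; apply: eq_integral => t _.
  by rewrite restrict_EFin /= patch_indic mulrC.
have mhp : measurable_fun setT (h \o p) by exact: measurableT_comp.
have mEh : measurable_fun setT (EFin \o h) by exact/measurable_EFinP.
have mhe : measurable_fun setT (fun x => (h x)%:E * e x)%E.
  exact: emeasurable_funM.
rewrite -(integral_mrestr P mB); last exact/measurable_EFinP.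
transitivity (\int[nu]_x (h x)%:E)%E.
  exact/esym/(integral_pushforward mp mEh ih measurableT).
transitivity (\int[mu]_x ((h x)%:E * e x))%E.
  rewrite Radon_Nikodym_change_of_variables//.
  exact: (integrable_pushforward mp mEh ih measurableT).
transitivity (\int[P]_t ((h (p t))%:E * e (p t)))%E.
  apply: (integral_pushforward mp mhe _ measurableT).
  apply: (@integrableMr _ _ _ P setT measurableT (h \o p) (e \o p)) => //.
  exists K; split; first by rewrite num_real.
  by move=> M KM t _ /=; exact: le_trans (hK (p t)) (ltW KM).
by apply: eq_integral => t _ /=; rewrite muleC EFinM fineK.
Qed.

End conditional_density.

(** * Differences of losses as sums over pairs of labels *)

Section loss_differences.
Context {R : realType} {q : nat}.
Implicit Types (t u : 'I_q -> R) (y : labels q).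

Lemma ell_le1 t j k : 0 <= ell t j k <= 1.
Proof. by rewrite /ell; case: ltgtP => _ /=; lra. Qed.

Lemma ellC t j k : ell t k j = 1 - ell t j k.
Proof. by rewrite /ell; case: ltgtP => _ /=; lra. Qed.

(** Pairs with equal labels contribute nothing; for the others [ellC] brings both orders to
    [ell t j k], and the constants cancel in the difference. *)
Lemma rank_lossB t u y : rank_loss t y - rank_loss u y =
  \sum_(j < q) \sum_(k < q | (j < k)%N)
    ((y j)%:R - (y k)%:R) * (ell u j k - ell t j k).
Proof.
rewrite /rank_loss -sumrB; apply: eq_bigr => j _.
rewrite -sumrB; apply: eq_bigr => k _; rewrite (ellC t) (ellC u).
by case: (y j); case: (y k) => /=; ring.
Qed.

(** Here the symmetry of [phi] does what [ellC] does for the ranking loss: reversing a pair only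
    changes the sign of the difference. *)
Lemma surr_lossB (phi : R -> R) t u y :
  (forall s, phi s + phi (- s) = 2 * phi 0) ->
  surr_loss phi t y - surr_loss phi u y =
  \sum_(j < q) \sum_(k < q | (j < k)%N)
    ((y j)%:R - (y k)%:R) * (phi (t j - t k) - phi (u j - u k)).
Proof.
move=> sym; rewrite /surr_loss -sumrB; apply: eq_bigr => j _.
rewrite -sumrB; apply: eq_bigr => k _.
have Nphi a b : phi (b - a) = 2 * phi 0 - phi (a - b).
  by have := sym (a - b); rewrite opprB; lra.
by rewrite (Nphi (t j)) (Nphi (u j)); case: (y j); case: (y k) => /=; ring.
Qed.

End loss_differences.

(** * The margin of [phi] and inequalities for a single pair *)

Section margin.
Context {R : realType} (phi : R -> R).
Hypothesis lb_phi : exists m : R, forall t, m <= phi t.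
Hypothesis phi_ninc : forall s t : R, s <= t -> phi t <= phi s.
Hypothesis phi_sym : forall t : R, phi t + phi (- t) = 2 * phi 0.

(** By the symmetry of [phi] this is also the distance from [phi 0] up to the supremum, hence half
    the oscillation of [phi]. *)
Definition margin : R := phi 0 - inf (range phi).

Let has_inf_phi : has_inf (range phi).
Proof.
split; first by exists (phi 0), 0.
by have [m mphi] := lb_phi; exists m => _ [t _ <-].
Qed.

Lemma phi_ge t : phi 0 - margin <= phi t.
Proof. by rewrite /margin subKr ge_inf//; exact: has_inf_phi.2. Qed.

Lemma phi_le t : phi t <= phi 0 + margin.
Proof. by have := phi_ge (- t); have := phi_sym t; lra. Qed.

Lemma margin_ge0 : 0 <= margin.
Proof. by have := phi_ge 0; lra. Qed.

(** With margin zero the bounds [phi_ge] and [phi_le] pinch [phi] to a constant, whose derivative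
    vanishes. *)
Lemma margin_gt0 : derive1 phi 0 < 0 -> 0 < margin.
Proof.
move=> dphi; rewrite lt_neqAle margin_ge0 andbT.
apply: contraTneq dphi => M0; rewrite -leNgt.
suff -> : phi = cst (phi 0) by rewrite derive1_cst.
apply/funext => t; apply/eqP; rewrite eq_le.
by have := phi_ge t; have := phi_le t; rewrite -M0 subr0 addr0 => -> ->.
Qed.

Lemma phi_near_inf e : 0 < e -> exists2 K, 0 < K & phi K <= phi 0 - margin + e.
Proof.
move=> e0; have [_ [t _ <-] tlt] := inf_adherent e0 has_inf_phi.
(* The maximum with 1 makes the point positive; monotonicity keeps [phi] close to its infimum
   there. *)
exists (Num.max t 1); first by rewrite lt_max ltr01 orbT.
apply: (le_trans (phi_ninc _)); last by rewrite /margin subKr; exact: ltW tlt.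
by rewrite le_max lexx.
Qed.

(* If [n |a|] exceeds the point where [phi] is [e]-close to its infimum, the
   defect is at most [e |a|]; otherwise [|a|] itself is small. *)
Lemma scaled_score_near_opt e : 0 < e ->
  exists n, forall a, a * (phi (n * a) - phi 0) + margin * `|a| <= e * (1 + `|a|).
Proof.
move=> e0; have [K K0 phiK] := phi_near_inf e0.
have M0 := margin_ge0.
(* Then [n * e = K * margin + e], so for [a >= 0] the case [n * a < K] forces [margin * a <= e]. The
   summand 1 keeps [n] positive even for margin zero. *)
pose n := K * margin / e + 1.
have n0 : 0 < n by rewrite /n ltr_wpDl// divr_ge0 ?(ltW e0) ?mulr_ge0 ?(ltW K0).
(* By the symmetry of [phi], [a * (phi (n * a) - phi 0)] is even in [a]. *)
suff pos a : 0 <= a -> a * (phi (n * a) - phi 0) + margin * a <= e * (1 + a).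
  exists n => a; have [a0|a0] := leP 0 a; first by rewrite ger0_norm//; exact: pos.
  rewrite ltr0_norm//; have := pos (- a); rewrite oppr_ge0 (ltW a0) => /(_ isT).
  by have := phi_sym (n * a); rewrite mulrN; nra.
move=> a0; have [na|na] := leP K (n * a).
  by have := phi_ninc na; nra.
have : phi (n * a) <= phi 0 by apply: phi_ninc; rewrite mulr_ge0// ltW.
have : margin * a <= e.
  have : n * e = K * margin + e by rewrite /n mulrDl mul1r divfK// gt_eqF.
  nra.
nra.
Qed.

(** If [t] orders the pair as the sign of [a] demands, the left side is nonpositive and the right
    side nonnegative, since [phi] stays within the margin of [phi 0]. Otherwise
    [a * (phi (t j - t k) - phi 0)] is nonnegative, and the left side is at most the margin times
    [|a|]. The number [l] stands for the [ell] of a competitor. *)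
Lemma ell_regret_le {q} (t : 'I_q -> R) j k (l a : R) : 0 <= l <= 1 ->
  margin * (a * (l - ell t j k)) <= margin * `|a| + a * (phi (t j - t k) - phi 0).
Proof.
move=> /andP[l0 l1]; have M0 := margin_ge0.
have Mal : 0 <= margin * `|a| * l by rewrite !mulr_ge0.
have Mal' : 0 <= margin * `|a| * (1 - l) by rewrite !mulr_ge0// subr_ge0.
have := phi_ge (t j - t k); have := phi_le (t j - t k); rewrite /ell.
have [tjk|tkj|->] := ltgtP (t j) (t k) => /=.
- have : phi 0 <= phi (t j - t k) by apply: phi_ninc; rewrite subr_le0 ltW.
  by move: Mal Mal'; case: ler0P => a0 *; nra.
- have : phi (t j - t k) <= phi 0 by apply: phi_ninc; rewrite subr_ge0 ltW.
  by move: Mal Mal'; case: ler0P => a0 *; nra.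
- rewrite subrr; move: Mal Mal'; case: ler0P => a0 *; nra.
Qed.

Lemma measurable_phi : measurable_fun setT phi.
Proof. by apply: nonincreasing_measurable => // s t; exact: phi_ninc. Qed.

End margin.

(** * Finite conditional sums under the integral *)

Section sums.
Context {d} {T : measurableType d} {R : realType}.

Lemma measurable_sum_cond {I : Type} (s : seq I) (Q : pred I) (h : I -> T -> R) :
  (forall i, Q i -> measurable_fun setT (h i)) ->
  measurable_fun setT (fun x => \sum_(i <- s | Q i) h i x).
Proof.
move=> mh; under eq_fun do rewrite big_mkcond/=.
apply: measurable_sum => i; case Qi: (Q i); [exact: mh|exact: measurable_cst].
Qed.

Variable mu : {measure set T -> \bar R}.

Lemma integrable_sumr {I : Type} (s : seq I) (Q : pred I) (h : I -> T -> R) :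
  (forall i, Q i -> mu.-integrable setT (EFin \o h i)) ->
  mu.-integrable setT (EFin \o (fun x => \sum_(i <- s | Q i) h i x)).
Proof.
move=> ih; rewrite (_ : EFin \o _ = (fun x => \sum_(i <- s | Q i) (h i x)%:E)%E).
  exact: (integrable_sum measurableT).
by apply/funext => x /=; rewrite sumEFin.
Qed.

Lemma Rintegral_sum {I : Type} (s : seq I) (Q : pred I) (h : I -> T -> R) :
  (forall i, Q i -> mu.-integrable setT (EFin \o h i)) ->
  \int[mu]_x (\sum_(i <- s | Q i) h i x) = \sum_(i <- s | Q i) \int[mu]_x h i x.
Proof.
move=> ih; elim: s => [|i s IHs].
  rewrite big_nil (_ : (fun _ => _) = cst 0) ?Rintegral_cst ?mul0r//.
  by apply/funext => x; rewrite big_nil.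
have -> : (fun x => \sum_(j <- i :: s | Q j) h j x) =
    fun x => if Q i then h i x + \sum_(j <- s | Q j) h j x
             else \sum_(j <- s | Q j) h j x.
  by apply/funext => x; rewrite big_cons.
rewrite big_cons; case: ifPn => // Qi; rewrite RintegralD ?IHs//; first exact: ih.
exact: integrable_sumr.
Qed.

End sums.

(** * Conditional label probabilities under the data distribution *)

Section regret.
Context {d} {X : measurableType d} {R : realType} {q : nat}.
Variable D : probability (X * labels q)%type R.
Implicit Types (f g : 'I_q -> X -> R).

Lemma measurable_labels (c : labels q -> R) :
  measurable_fun setT (fun z : X * labels q => c z.2).
Proof. exact: (@measurableT_comp _ _ _ _ _ _ c). Qed.

Lemma measurable_natb (b : X -> bool) :
  measurable_fun setT b -> measurable_fun setT (fun x => (b x)%:R : R).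
Proof.
move=> mb; rewrite (_ : (fun _ => _) = fun x => if b x then 1 else 0).
  exact: measurable_fun_ifT.
by apply/funext => x; case: (b x).
Qed.

Lemma measurable_ell f j k : meas_scorer f ->
  measurable_fun setT (fun x => ell (f^~ x) j k).
Proof.
move=> mf; rewrite /ell; apply: measurable_funD.
  by apply: measurable_natb; exact: measurable_fun_ltr.
apply: measurable_funM => //.
by apply: measurable_natb; exact: measurable_fun_eqr.
Qed.

(* [eta j] is a version of the conditional probability P(y_j = +1 | x). *)
Definition label_density (eta : 'I_q -> X -> R) : Prop :=
  [/\ meas_scorer eta,
      forall j, D.-integrable setT (EFin \o (fun z : X * labels q => eta j z.1)) &
      forall j (h : X -> R) (K : R), measurable_fun setT h ->
        (forall x, `|h x| <= K) ->
        \int[D]_(z in setT) ((z.2 j)%:R * h z.1) =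
        \int[D]_(z in setT) (eta j z.1 * h z.1)].

Lemma exists_label_density : exists eta, label_density eta.
Proof.
have mB j : measurable [set z : X * labels q | z.2 j].
  rewrite -[X in measurable X]setTI.
  have := (@measurable_snd _ _ X (labels q) measurableT [set y : labels q | y j] I).
  exact.
have [eta etaP] := choice (fun j => conditional_density D measurable_fst (mB j)).
exists eta; split => [j|j|j h K mh hK]; try by have [] := etaP j.
have [_ _ /(_ h K mh hK) <-] := etaP j.
by apply: eq_Rintegral => z _; rewrite indicE mem_setE.
Qed.

(** Each [u j k] is a bounded function of [x] alone, hence an admissible test function for [eta];
    linearity of the integral does the rest. *)
Lemma pairwise_density (eta : 'I_q -> X -> R) (u : 'I_q -> 'I_q -> X -> R) (K : R) :
  label_density eta ->
  (forall j k, measurable_fun setT (u j k)) ->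
  (forall j k x, `|u j k x| <= K) ->
  D.-integrable setT (EFin \o (fun z : X * labels q =>
    \sum_(j < q) \sum_(k < q | (j < k)%N) (eta j z.1 - eta k z.1) * u j k z.1)) /\
  \int[D]_z (\sum_(j < q) \sum_(k < q | (j < k)%N)
    ((z.2 j)%:R - (z.2 k)%:R) * u j k z.1) =
  \int[D]_z (\sum_(j < q) \sum_(k < q | (j < k)%N)
    (eta j z.1 - eta k z.1) * u j k z.1).
Proof.
move=> [meta ieta etaP] mu uK.
have mu1 j k : measurable_fun setT (fun z : X * labels q => u j k z.1).
  exact: (measurableT_comp (mu j k)).
have iyu i j k : D.-integrable setT
    (EFin \o (fun z : X * labels q => (z.2 i)%:R * u j k z.1)).
  apply: (@bounded_integrable _ _ _ D _ K) => [|z].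
    apply: measurable_funM => //.
    exact: (measurable_labels (fun y => (y i)%:R)).
  rewrite normrM; case: (z.2 i); rewrite ?normr1 ?mul1r ?normr0 ?mul0r//.
  exact: le_trans (uK j k z.1).
have ieu i j k : D.-integrable setT
    (EFin \o (fun z : X * labels q => eta i z.1 * u j k z.1)).
  apply: (@integrableMl _ _ _ D setT measurableT
    (EFin \o (fun z => eta i z.1)) (fun z => u j k z.1)) => //.
  exists K; split; first by rewrite num_real.
  by move=> M KM z _; exact: le_trans (uK _ _ _) (ltW KM).
have iyyu j k : D.-integrable setT
    (EFin \o (fun z : X * labels q => ((z.2 j)%:R - (z.2 k)%:R) * u j k z.1)).
  have := integrableB measurableT (iyu j j k) (iyu k j k).
  by apply: eq_integrable => // z _; rewrite /= mulrBl EFinB.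
have ieeu j k : D.-integrable setT
    (EFin \o (fun z : X * labels q => (eta j z.1 - eta k z.1) * u j k z.1)).
  have := integrableB measurableT (ieu j j k) (ieu k j k).
  by apply: eq_integrable => // z _; rewrite /= mulrBl EFinB.
split; first by do 2 (apply: integrable_sumr => ? _).
rewrite !Rintegral_sum; try by move=> *; apply: integrable_sumr.
apply: eq_bigr => j _; rewrite !Rintegral_sum//; apply: eq_bigr => k _.
under eq_Rintegral do rewrite mulrBl.
under [RHS]eq_Rintegral do rewrite mulrBl.
by rewrite !RintegralB// !(etaP _ _ K).
Qed.

Lemma norm_pair_sum_le (v : 'I_q -> 'I_q -> R) (C : R) :
  (forall j k, `|v j k| <= C) ->
  `|\sum_(j < q) \sum_(k < q | (j < k)%N) v j k| <=
    \sum_(j < q) \sum_(k < q | (j < k)%N) C.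
Proof.
move=> vC; apply: (le_trans (ler_norm_sum _ _ _)); apply: ler_sum => j _.
by apply: (le_trans (ler_norm_sum _ _ _)); apply: ler_sum => k _.
Qed.

Lemma rank_loss_integrable f : meas_scorer f ->
  D.-integrable setT (EFin \o (fun z : X * labels q => rank_loss (f^~ z.1) z.2)).
Proof.
move=> mf; apply: (@bounded_integrable _ _ _ D) => [|z]; last first.
  apply: (norm_pair_sum_le (C := 1)) => j k.
  have := ell_le1 (f^~ z.1) j k; have := ell_le1 (f^~ z.1) k j.
  by rewrite ler_norml; case: (z.2 j); case: (z.2 k) => /=; lra.
apply: measurable_sum => j; apply: measurable_sum_cond => k _.
apply: measurable_funD; apply: measurable_funM.
- exact: (measurable_labels (fun y => (~~ y j && y k)%:R)).
- exact: (measurableT_comp (measurable_ell j k mf)).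
- exact: (measurable_labels (fun y => (y j && ~~ y k)%:R)).
- exact: (measurableT_comp (measurable_ell k j mf)).
Qed.

(** * Surrogate risks and the comparison of regrets *)

Variable phi : R -> R.
Hypothesis lb_phi : exists m : R, forall t, m <= phi t.
Hypothesis phi_ninc : forall s t : R, s <= t -> phi t <= phi s.
Hypothesis phi_sym : forall t : R, phi t + phi (- t) = 2 * phi 0.

Let mphi := measurable_phi phi_ninc.

Lemma measurable_phi_diff f j k : meas_scorer f ->
  measurable_fun setT (fun x => phi (f j x - f k x)).
Proof. by move=> mf; apply: measurableT_comp => //; exact: measurable_funB. Qed.

Lemma phi_norm_le t : `|phi t| <= `|phi 0| + margin phi.
Proof.
have := phi_ge lb_phi t; have := phi_le lb_phi phi_sym t.
have := ler_norm (phi 0); have := ler_norm (- phi 0); rewrite normrN => *.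
by rewrite ler_norml; apply/andP; split; lra.
Qed.

Let C := \sum_(j < q) \sum_(k < q | (j < k)%N) (`|phi 0| + margin phi).

(** The bound is uniform in the scores: it gives integrability for every scorer and bounds the set
    of surrogate risks below. *)
Lemma surr_loss_bound (t : 'I_q -> R) y : `|surr_loss phi t y| <= C.
Proof.
apply: norm_pair_sum_le => j k.
have M0 := margin_ge0 lb_phi; have phi0 := normr_ge0 (phi 0).
have := phi_norm_le (t j - t k); have := phi_norm_le (t k - t j).
rewrite !ler_norml => /andP[? ?] /andP[? ?].
by case: (y j); case: (y k) => /=; apply/andP; split; lra.
Qed.

Lemma surr_loss_integrable f : meas_scorer f ->
  D.-integrable setT (EFin \o (fun z : X * labels q => surr_loss phi (f^~ z.1) z.2)).
Proof.
move=> mf; apply: (@bounded_integrable _ _ _ D _ C) => [|z]; last exact: surr_loss_bound.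
apply: measurable_sum => j; apply: measurable_sum_cond => k _.
apply: measurable_funD; apply: measurable_funM.
- exact: (measurable_labels (fun y => (y j && ~~ y k)%:R)).
- exact: (measurableT_comp (measurable_phi_diff j k mf)).
- exact: (measurable_labels (fun y => (~~ y j && y k)%:R)).
- exact: (measurableT_comp (measurable_phi_diff k j mf)).
Qed.

Lemma surr_bayes_le f : meas_scorer f ->
  bayes_risk D (surr_loss phi) <= risk D (surr_loss phi) f.
Proof.
move=> mf; apply: ge_inf; last by exists f.
exists (- C) => _ [g mg <-]; rewrite /risk.
have -> : - C = \int[D]_z (cst (- C) z).
  by rewrite Rintegral_cst//= probability_setT mulr1.
apply: le_Rintegral => //; last 2 first.
- exact: surr_loss_integrable.
- by move=> z _; have := surr_loss_bound (g^~ z.1) z.2; rewrite ler_norml => /andP[].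
- by apply: (@bounded_integrable _ _ _ D _ `|C|) => // z; rewrite normrN.
Qed.

(** The competitor [g] is arbitrary, so no minimizer of the ranking risk has to be constructed. The
    surrogate Bayes risk is compared with the risk of a scaled [eta], at the cost of an arbitrarily
    small [e]. *)
Lemma rank_regret_le f g : meas_scorer f -> meas_scorer g ->
  margin phi * (risk D (@rank_loss R q) f - risk D (@rank_loss R q) g) <=
  risk D (surr_loss phi) f - bayes_risk D (surr_loss phi).
Proof.
move=> mf mg; have [eta etaP] := exists_label_density; have [meta ieta _] := etaP.
have M0 := margin_ge0 lb_phi.
have iZ c (F : X * labels q -> R) : D.-integrable setT (EFin \o F) ->
    D.-integrable setT (EFin \o (fun z => c * F z)).
  move=> /(integrableZl measurableT c).
  by apply: eq_integrable => // z _; rewrite /= EFinM.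
have iD (F G : X * labels q -> R) : D.-integrable setT (EFin \o F) ->
    D.-integrable setT (EFin \o G) ->
    D.-integrable setT (EFin \o (fun z => F z + G z)).
  move=> iF iG; have := integrableD measurableT iF iG.
  by apply: eq_integrable => // z _; rewrite /= EFinD.
(* Up to a factor, [S] is the total over all pairs of the defects allowed by
   [scaled_score_near_opt]. *)
pose S : X * labels q -> R := fun z => \sum_(j < q) \sum_(k < q | (j < k)%N)
  (1 + `|eta j z.1 - eta k z.1|).
have iS : D.-integrable setT (EFin \o S).
  apply: integrable_sumr => j _; apply: integrable_sumr => k _; apply: iD.
    by apply: (@bounded_integrable _ _ _ D _ 1) => // z; rewrite normr1.
  apply: (@integrable_norm _ _ _ D setT (fun z => eta j z.1 - eta k z.1)).
  have := integrableB measurableT (ieta j) (ieta k).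
  by apply: eq_integrable => // z _; rewrite /= EFinB.
have S0 : 0 <= \int[D]_z S z.
  by apply: Rintegral_ge0 => z _; do 2 (apply: sumr_ge0 => ? _); rewrite addr_ge0.
apply/ler_addgt0Pr => e e0.
(* Chosen so that the integrated defect [e1 * \int[D]_z S z] stays below [e]; the 1 keeps the
   denominator positive. *)
pose e1 := e / (1 + \int[D]_z S z).
have e10 : 0 < e1 by rewrite divr_gt0// ltr_wpDr.
have [n nP] := scaled_score_near_opt lb_phi phi_ninc phi_sym e10.
(* The differences of [h] are [n] times those of [eta], so the single [n] serves all pairs and all
   points. *)
pose h (j : 'I_q) x := n * eta j x.
have mh : meas_scorer h by move=> j; apply: measurable_funM.
have mphiB (f1 f2 : 'I_q -> X -> R) j k : meas_scorer f1 -> meas_scorer f2 ->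
    measurable_fun setT (fun x => phi (f1 j x - f1 k x) - phi (f2 j x - f2 k x)).
  by move=> mf1 mf2; apply: measurable_funB; exact: measurable_phi_diff.
have [ir Er] := @pairwise_density eta
  (fun j k x => ell (g^~ x) j k - ell (f^~ x) j k) 1 etaP
  (fun j k => measurable_funB (measurable_ell j k mg) (measurable_ell j k mf))
  (fun j k x => ltac:(
     have := ell_le1 (g^~ x) j k; have := ell_le1 (f^~ x) j k;
     rewrite ler_norml; lra)).
(* The bound is twice the margin because both values of [phi] lie within the margin of [phi 0]. *)
have [is_ Es] := @pairwise_density eta
  (fun j k x => phi (f j x - f k x) - phi (h j x - h k x)) (2 * margin phi) etaP
  (fun j k => mphiB f h j k mf mh)
  (fun j k x => ltac:(
     have := phi_ge lb_phi (f j x - f k x);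
     have := phi_le lb_phi phi_sym (f j x - f k x);
     have := phi_ge lb_phi (h j x - h k x);
     have := phi_le lb_phi phi_sym (h j x - h k x);
     rewrite ler_norml => *; apply/andP; split; lra)).
have rankE : risk D (@rank_loss R q) f - risk D (@rank_loss R q) g =
    \int[D]_z (\sum_(j < q) \sum_(k < q | (j < k)%N)
      (eta j z.1 - eta k z.1) * (ell (g^~ z.1) j k - ell (f^~ z.1) j k)).
  rewrite -Er /risk -RintegralB//; [|exact: rank_loss_integrable..].
  by apply: eq_Rintegral => z _; rewrite rank_lossB.
have surrE : risk D (surr_loss phi) f - risk D (surr_loss phi) h =
    \int[D]_z (\sum_(j < q) \sum_(k < q | (j < k)%N)
      (eta j z.1 - eta k z.1) *
      (phi (f j z.1 - f k z.1) - phi (h j z.1 - h k z.1))).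
  rewrite -Es /risk -RintegralB//; [|exact: surr_loss_integrable..].
  by apply: eq_Rintegral => z _; rewrite surr_lossB.
suff le_h : margin phi * (risk D (@rank_loss R q) f - risk D (@rank_loss R q) g) <=
    risk D (surr_loss phi) f - risk D (surr_loss phi) h + e1 * \int[D]_z S z.
  apply: (le_trans le_h); have := surr_bayes_le mh.
  have : e1 * (1 + \int[D]_z S z) = e by rewrite /e1 divfK// gt_eqF// ltr_wpDr.
  by have := e10; lra.
rewrite rankE surrE -!RintegralZl// -RintegralD//; last exact: iZ.
apply: le_Rintegral => //; [exact: iZ|by apply: iD => //; exact: iZ|].
move=> z _; rewrite !mulr_sumr -big_split; apply: ler_sum => j _.
rewrite !mulr_sumr -big_split; apply: ler_sum => k _ /=.
(* With [a] the difference of the [eta], [ell_regret_le] leaves the margin times [|a|] plus the term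
   of [f]; [nP] trades the former for the term of [h] and the defect. *)
have := nP (eta j z.1 - eta k z.1).
have := ell_regret_le lb_phi phi_ninc phi_sym (f^~ z.1) j k
  (eta j z.1 - eta k z.1) (ell_le1 (g^~ z.1) j k).
rewrite /h -mulrBr; lra.
Qed.

End regret.

(** * Consistency with a linear [xi] *)

Theorem theorem5 (R : realType) (q : nat) (phi : R -> R)
  (d : measure_display) (X : measurableType d) :
  (2 <= q)%N ->
  (exists m : R, forall t, m <= phi t) ->
  (forall t : R, derivable phi t 1) ->
  (forall s t : R, s <= t -> phi t <= phi s) ->
  derive1 phi 0 < 0 ->
  (forall t : R, phi t + phi (- t) = 2 * phi 0) ->
  exists xi : R -> R,
    [/\ forall t, 0 <= t -> 0 <= xi t,
        forall s t, 0 <= s -> s <= t -> xi s <= xi t,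
        forall s t (l : R), 0 <= s -> 0 <= t -> 0 <= l -> l <= 1 ->
          l * xi s + (1 - l) * xi t <= xi (l * s + (1 - l) * t),
        xi 0 = 0 &
        (xi x @[x --> 0^'+] --> 0)] /\
        forall (D : probability (X * labels q)%type R) (f : 'I_q -> X -> R),
          meas_scorer f ->
          risk D (@rank_loss R q) f - bayes_risk D (@rank_loss R q)
          <= xi (risk D (surr_loss phi) f - bayes_risk D (surr_loss phi)).
Proof.
move=> _ lb_phi _ phi_ninc dphi phi_sym.
have M0 := margin_gt0 lb_phi phi_sym dphi.
exists (fun t => t / margin phi); split; first split.
- by move=> t t0; rewrite divr_ge0// ltW.
- by move=> s t _ st; rewrite ler_pM2r// invr_gt0.
- by move=> s t l *; rewrite !mulrA -mulrDl.
- by rewrite mul0r.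
- apply: cvg_at_right_filter; rewrite -[X in _ --> X](mul0r (margin phi)^-1).
  by apply: cvgM; [exact: cvg_id|exact: cvg_cst].
(* With the Bayes ranking risk isolated, it is enough to bound the risk of every competitor [g] from
   below; [f] itself shows that the set of risks is nonempty. *)
move=> D f mf; rewrite lerBlDr -lerBlDl; apply: lb_le_inf.
  by exists (risk D (@rank_loss R q) f), f.
move=> _ [g mg <-]; rewrite lerBlDl -lerBlDr ler_pdivlMr// mulrC.
exact: rank_regret_le.
Qed.
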